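(* Let $G$ be a left brace. Let $X$ be a subset of $G$, invariant under the action $\lambda$ of $(G,\cdot)$ on $G$, such that $X$ generates the additive group $(G,+)$. Let $X=\bigcup_{i\in I} X_i$ be the decomposition of $X$ as a disjoint union of $\lambda$-orbits, and choose an element $x_i\in X_i$ for every $i\in I$. Let $H_i=\operatorname{St}(x_i)=\{g\in G\mid \lambda_g(x_i)=x_i\}$ be the stabilizer of $x_i$ in $(G,\cdot)$. For each $i\in I$, let $J_i$ be a nonempty set and let $(K_{i,j})_{j\in J_i}$ be a family of subgroups of $H_i$, such that $\bigcap_{i\in I}\bigcap_{j\in J_i}\operatorname{core}(K_{i,j})=\{1\}$. Let $Y:=\bigcup_{i\in I}\bigcup_{j\in J_i} G/K_{i,j}$ be the disjoint union of the sets of left cosets $G/K_{i,j}$ (so that distinct indices $(i,j)$ give disjoint copies even when the subgroups coincide). Let $s\colon Y\times Y\to Y\times Y$ be the map $$s(g_1K_{i_1,j_1},\,g_2K_{i_2,j_2})=\bigl(f_{g_1K_{i_1,j_1}}(g_2K_{i_2,j_2}),\ f^{-1}_{f_{g_1K_{i_1,j_1}}(g_2K_{i_2,j_2})}(g_1K_{i_1,j_1})\bigr),$$ where $f_{g_1K_{i_1,j_1}}(g_2K_{i_2,j_2})=\lambda_{g_1}(x_{i_1})\,g_2K_{i_2,j_2}$ (the product $\lambda_{g_1}(x_{i_1})\cdot g_2$ being taken in $(G,\cdot)$). Then $(Y,s)$ is a solution of the YBE such that $\mathcal{G}(Y,s)\cong G$ as left braces. Moreover, any solution $(Z,t)$ of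 the YBE with $\mathcal{G}(Z,t)\cong G$ as left braces is isomorphic to a solution $(Y,s)$ of this form, that is, with $Y=\bigcup_{i\in I}\bigcup_{j\in J_i} G/K_{i,j}$ (disjoint union) and $s$ given by the displayed formula with $f_{g_1K_{i_1,j_1}}(g_2K_{i_2,j_2})=\lambda_{g_1}(x_{i_1})\,g_2K_{i_2,j_2}$, for some $\lambda$-invariant subset $X=\bigcup_{i\in I}X_i$ of $G$ (disjoint union of $\lambda$-orbits $X_i$) generating $(G,+)$, some elements $x_i\in X_i$, some nonempty sets $J_i$, and some families $(K_{i,j})_{j\in J_i}$ of subgroups of $\operatorname{St}(x_i)$ ($i\in I$) such that $\bigcap_{i\in I}\bigcap_{j\in J_i}\operatorname{core}(K_{i,j})=\{1\}$.
   Context: A left brace is a set $B$ with two binary operations $+$ and $\cdot$ such that $(B,+)$ is an abelian group, $(B,\cdot)$ is a group, and $x\cdot(y+z)+x=x\cdot y+x\cdot z$ for all $x,y,z\in B$. A morphism of left braces is a map preserving both $+$ and $\cdot$; an isomorphism is a bijective morphism. For $x\in B$ define $\lambda_x\colon B\to B$ by $\lambda_x(y)=xy-x$. Each $\lambda_x$ is an automorphism of $(B,+)$, and $x\mapsto\lambda_x$ is a group morphism $\lambda\colon(B,\cdot)\to\operatorname{Aut}(B,+)$; this is the action $\lambda$ of $(B,\cdot)$ on $B$. Orbits, invariance and stabilizers refer to this action. Subgroups and cosets are taken in $(G,\cdot)$. For a subgroup $K$ of $(G,\cdot)$, $\operatorname{core}(K)=\bigcap_{g\in G}gKg^{-1}$.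 A solution of the YBE is a pair $(X,r)$, with $X$ a set and $r\colon X\times X\to X\times X$, $r(x,y)=(\sigma_x(y),\gamma_y(x))$, a map satisfying $r_{12}r_{23}r_{12}=r_{23}r_{12}r_{23}$ on $X\times X\times X$ (where $r_{ij}$ acts as $r$ on components $i,j$ and as the identity on the remaining one), which is involutive ($r^2=\mathrm{id}$) and non-degenerate (all maps $\sigma_x$ and $\gamma_x$ are bijections of $X$). An isomorphism of solutions $(X,r)\to(Y,s)$ is a bijection $F\colon X\to Y$ with $s\circ(F\times F)=(F\times F)\circ r$. The structure group of a solution $(X,r)$ is $G(X,r)=\langle x\in X\mid xy=\sigma_x(y)\gamma_y(x)\text{ for all }x,y\in X\rangle$. Let $\mathbb{Z}^{(X)}$ be the free abelian group with basis $X$, and let $\operatorname{Sym}_X$ act on it by permuting the basis. It is known that $x\mapsto(x,\sigma_x)$ extends to a group homomorphism $G(X,r)\to\mathbb{Z}^{(X)}\rtimes\operatorname{Sym}_X$, $g\mapsto(\pi(g),\phi(g))$, such that $\pi\colon G(X,r)\to\mathbb{Z}^{(X)}$ is bijective. With $g+h:=\pi^{-1}(\pi(g)+\pi(h))$, $G(X,r)$ is a left brace. The permutation group is $\mathcal{G}(X,r)=\{\phi(g)\mid g\in G(X,r)\}=\langle\sigma_x\mid x\in X\rangle\le\operatorname{Sym}_X$; with composition as multiplication and the (well-defined) addition $\phi(g)+\phi(h)=\phi(g+h)$, it is a left brace. *)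

(* Defs.v *)
From HB Require Import structures.
From mathcomp Require Import all_boot all_algebra.
From mathcomp Require Import boolp classical_sets freeg.

Set Implicit Arguments.
Unset Strict Implicit.
Unset Printing Implicit Defensive.

Import GRing.Theory.

Local Open Scope group_scope.

HB.mixin Record isLeftBrace B of GRing.Zmodule B & Group B := {
  braceP : forall x y z : B,
    ((x * (y + z)%R)%g + x = (x * y)%g + (x * z)%g)%R
}.

#[short(type="leftBraceType")]
HB.structure Definition LeftBrace :=
  {B of GRing.Zmodule B & Group B & isLeftBrace B}.

Definition brace_iso (A B : leftBraceType) : Prop :=
  exists F : A -> B,
    [/\ bijective F,
        forall x y, F (x + y)%R = (F x + F y)%R
      & forall x y, F (x * y) = F x * F y].

Record sym (X : Type) := Sym {
  sym_fun :> X -> X;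
  sym_inv : X -> X;
  symK : cancel sym_fun sym_inv;
  symVK : cancel sym_inv sym_fun
}.

HB.instance Definition _ (X : Type) := gen_eqMixin (sym X).
HB.instance Definition _ (X : Type) := gen_choiceMixin (sym X).

Section SymGroup.
Variable X : Type.
Implicit Types p q : sym X.

Lemma symP p q : (forall x, p x = q x) -> p = q.
Proof.
case: p q => [f g fK gK] [f' g' fK' gK'] /= /funext E.
case: f' / E fK' gK' => fK' gK'.
have E : g = g' by apply/funext => x; rewrite -{1}(gK' x) fK.
case: g' / E fK' gK' => fK' gK'.
by congr Sym; exact: Prop_irrelevance.
Qed.

Definition sym_one : sym X := @Sym X id id (fun=> erefl) (fun=> erefl).
Definition sym_opp p : sym X := @Sym X (sym_inv p) p (@symVK X p) (@symK X p).
Definition sym_mul p q : sym X :=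
  @Sym X (p \o q) (sym_inv q \o sym_inv p)
    (can_comp (@symK X p) (@symK X q)) (can_comp (@symVK X q) (@symVK X p)).

Lemma sym_mulA : associative sym_mul. Proof. by move=> p q r; exact: symP. Qed.
Lemma sym_mul1 : left_id sym_one sym_mul. Proof. by move=> p; exact: symP. Qed.
Lemma sym_mulr1 : right_id sym_one sym_mul.
Proof. by move=> p; exact: symP. Qed.
Lemma sym_mulV : left_inverse sym_one sym_opp sym_mul.
Proof. by move=> p; apply: symP => x /=; rewrite symK. Qed.
Lemma sym_mulrV : right_inverse sym_one sym_opp sym_mul.
Proof. by move=> p; apply: symP => x /=; rewrite symVK. Qed.

HB.instance Definition _ := isGroup.Build (sym X)
  sym_mulA sym_mul1 sym_mulr1 sym_mulV sym_mulrV.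

Lemma symME p q x : (p * q) x = p (q x). Proof. by []. Qed.
Lemma sym1E x : (1 : sym X) x = x. Proof. by []. Qed.
Lemma symVE p x : p^-1 x = sym_inv p x. Proof. by []. Qed.
Lemma symgK p x : p^-1 (p x) = x. Proof. exact: symK. Qed.
Lemma symgVK p x : p (p^-1 x) = x. Proof. exact: symVK. Qed.

Lemma sym_of_bij (f : X -> X) : bijective f -> {p : sym X | sym_fun p = f}.
Proof. by move=> /(fun h => cid (let: Bijective g fK gK := h in
  ex_intro (fun p : sym X => sym_fun p = f) (Sym fK gK) erefl)). Qed.

End SymGroup.

Section YBE.
Variables (X : Type) (r : X * X -> X * X).

Definition r12 (p : X * X * X) : X * X * X := (r p.1, p.2).
Definition r23 (p : X * X * X) : X * X * X :=
  let q := r (p.1.2, p.2) in (p.1.1, q.1, q.2).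

Definition sigma (x y : X) : X := (r (x, y)).1.
Definition gamma (y x : X) : X := (r (x, y)).2.

Definition is_solution : Prop :=
  [/\ forall p, r12 (r23 (r12 p)) = r23 (r12 (r23 p)),
      forall p, r (r p) = p,
      forall x, bijective (sigma x)
    & forall y, bijective (gamma y)].

End YBE.

Record solution := Solution {
  sol_carrier :> Type;
  sol_map : sol_carrier * sol_carrier -> sol_carrier * sol_carrier;
  sol_axiom : is_solution sol_map
}.

Definition solution_iso (S T : solution) : Prop :=
  exists F : S -> T, bijective F /\
    forall x y : S, sol_map (F x, F y) =
      let p := sol_map (x, y) in (F p.1, F p.2).

Section SolutionTheory.
Variable S : solution.
Implicit Types x y z : S.

Local Notation r := (@sol_map S).
Local Notation gam := (gamma r).

Definition sigp x : sym S :=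
  sval (sym_of_bij (let: And4 _ _ h _ := sol_axiom S in h x)).

Lemma sigpE x y : sigp x y = sigma r x y.
Proof. by rewrite /sigp; case: sym_of_bij => p /= ->. Qed.

Lemma gam_inj y : injective (gam y).
Proof. by case: (sol_axiom S) => _ _ _ /(_ y) /bij_inj. Qed.

Lemma gam_surj y z : exists x, gam y x = z.
Proof. by case: (sol_axiom S) => _ _ _ /(_ y) [g _ gK]; exists (g z). Qed.

Lemma solE x y : r (x, y) = (sigp x y, gam y x).
Proof. by rewrite sigpE /sigma /gamma; case: (r _). Qed.

Lemma sol_invo x y :
  sigp (sigp x y) (gam y x) = x /\ gam (gam y x) (sigp x y) = y.
Proof.
case: (sol_axiom S) => _ /(_ (x, y)) + _ _.
by rewrite !solE => -[-> ->].
Qed.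

Lemma gamE x y : gam y x = (sigp (sigp x y))^-1 x.
Proof. by rewrite -{3}(sol_invo x y).1 symgK. Qed.

Lemma sigpM x y : sigp x * sigp y = sigp (sigp x y) * sigp (gam y x).
Proof.
apply: symP => z; rewrite !symME.
case: (sol_axiom S) => /(_ (x, y, z)) + _ _ _.
by rewrite /r12 /r23 /= !solE /= ?solE => -[-> _ _].
Qed.

Definition diag x : S := (sigp x)^-1 x.

Lemma gam_diag x : gam (diag x) x = diag x.
Proof. by rewrite gamE /diag symgVK. Qed.

Lemma diag_inj : injective diag.
Proof.
by move=> x y E; apply: (@gam_inj (diag x)); rewrite gam_diag E gam_diag.
Qed.

Lemma diag_surj y : exists x, diag x = y.
Proof.
have [x Ex] := gam_surj y y; exists x; rewrite /diag.
suff E : sigp x y = x by rewrite -{2}E symgK.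
by apply: (@gam_inj y); have [_] := sol_invo x y; rewrite Ex.
Qed.

End SolutionTheory.

Section StructureGroup.
Variable S : solution.

(* (x, false) stands for the generator x and (x, true) for its inverse *)
Definition word := seq ({classic S} * bool).

Implicit Types u v w : word.

Local Notation pos x := ((x : {classic S}), false).

Inductive word_equiv : word -> word -> Prop :=
| word_refl u : word_equiv u u
| word_sym u v : word_equiv u v -> word_equiv v u
| word_trans u v w : word_equiv u v -> word_equiv v w -> word_equiv u w
| word_cat u u' v v' :
    word_equiv u u' -> word_equiv v v' -> word_equiv (u ++ v) (u' ++ v')
| word_cancel (x : S) (b : bool) :
    word_equiv [:: (x : {classic S}, b); (x : {classic S}, ~~ b)] [::]
| word_rel (x y : S) :
    word_equiv [:: pos x; pos y]
      [:: pos (sigma (@sol_map S) x y); pos (gamma (@sol_map S) y x)].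

Definition word_eqb (u v : word) : bool := `[< word_equiv u v >].

Lemma word_eqb_refl : reflexive word_eqb.
Proof. by move=> u; apply/asboolP/word_refl. Qed.

Lemma word_eqb_sym : symmetric word_eqb.
Proof. by move=> u v; apply/asboolP/asboolP; exact: word_sym. Qed.

Lemma word_eqb_trans : transitive word_eqb.
Proof.
by move=> v u w /asboolP uv /asboolP vw; apply/asboolP/(word_trans uv).
Qed.

Canonical word_equivRel :=
  EquivRel word_eqb word_eqb_refl word_eqb_sym word_eqb_trans.

Definition structGroup := {eq_quot word_eqb}%qT.

HB.instance Definition _ := Choice.on structGroup.
HB.instance Definition _ := EqQuotient.on structGroup.

Definition cls u : structGroup := (\pi_structGroup u)%qT.

Lemma clsP u v : cls u = cls v <-> word_equiv u v.
Proof.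
split=> [/(@eqquotP _ _ structGroup) /asboolP //|h].
by apply/(@eqquotP _ _ structGroup)/asboolP.
Qed.

Lemma cls_surj (g : structGroup) : exists u, g = cls u.
Proof. by exists (repr g); rewrite /cls reprK. Qed.

Lemma repr_cls u : word_equiv (repr (cls u)) u.
Proof. by apply/clsP; rewrite /cls reprK. Qed.

Definition word_inv u : word := rev [seq (l.1, ~~ l.2) | l <- u].

Lemma word_invK u : word_inv (word_inv u) = u.
Proof.
rewrite /word_inv map_rev revK -map_comp -[RHS]map_id.
by apply: eq_map => -[x b] /=; rewrite negbK.
Qed.

Lemma word_invl u : word_equiv (u ++ word_inv u) [::].
Proof.
elim: u => [|[x b] u IH]; first exact: word_refl.
rewrite /word_inv map_cons rev_cons -cats1 -/(word_inv u).
apply: word_trans (word_cancel x b).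
rewrite -[_ :: u]cat1s -[_ :: [:: _]]cat1s -catA.
apply: word_cat (word_refl _) _; rewrite catA.
exact: word_cat IH (word_refl _).
Qed.

Lemma word_inv_equiv u v : word_equiv u v -> word_equiv (word_inv u) (word_inv v).
Proof.
move=> uv.
have h : word_equiv (word_inv u ++ v) [::].
  apply: word_trans (word_cat (word_refl _) (word_sym uv)) _.
  by rewrite -{2}(word_invK u); exact: word_invl.
rewrite -[word_inv v]cat0s -[word_inv u]cats0.
apply: word_trans (word_cat (word_refl _) (word_sym (word_invl v))) _.
by rewrite catA; exact: word_cat h (word_refl _).
Qed.

Definition sg_one : structGroup := cls [::].
Definition sg_mul (g h : structGroup) : structGroup := cls (repr g ++ repr h).
Definition sg_inv (g : structGroup) : structGroup := cls (word_inv (repr g)).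

Lemma sg_mulE u v : sg_mul (cls u) (cls v) = cls (u ++ v).
Proof. by apply/clsP; apply: word_cat; exact: repr_cls. Qed.

Lemma sg_invE u : sg_inv (cls u) = cls (word_inv u).
Proof. by apply/clsP; apply: word_inv_equiv; exact: repr_cls. Qed.

Lemma sg_mulA : associative sg_mul.
Proof.
move=> g h k; case: (cls_surj g) (cls_surj h) (cls_surj k).
by move=> u -> [v ->] [w ->]; rewrite !sg_mulE catA.
Qed.

Lemma sg_mul1 : left_id sg_one sg_mul.
Proof. by move=> g; case: (cls_surj g) => u ->; rewrite sg_mulE. Qed.

Lemma sg_mulr1 : right_id sg_one sg_mul.
Proof. by move=> g; case: (cls_surj g) => u ->; rewrite sg_mulE cats0. Qed.

Lemma sg_mulrV : right_inverse sg_one sg_inv sg_mul.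
Proof.
move=> g; case: (cls_surj g) => u ->; rewrite sg_invE sg_mulE.
by apply/clsP/word_invl.
Qed.

Lemma sg_mulV : left_inverse sg_one sg_inv sg_mul.
Proof.
move=> g; case: (cls_surj g) => u ->; rewrite sg_invE sg_mulE.
by apply/clsP; rewrite -{2}(word_invK u); exact: word_invl.
Qed.

HB.instance Definition _ := isGroup.Build structGroup
  sg_mulA sg_mul1 sg_mulr1 sg_mulV sg_mulrV.

Definition sg_gen (x : S) : structGroup := cls [:: pos x].

Lemma sg_relP (x y : S) : sg_gen x * sg_gen y =
  sg_gen (sigma (@sol_map S) x y) * sg_gen (gamma (@sol_map S) y x).
Proof. by rewrite [LHS]sg_mulE [RHS]sg_mulE; apply/clsP/word_rel. Qed.

Lemma cls_letter (x : S) b :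
  cls [:: (x : {classic S}, b)] = if b then (sg_gen x)^-1 else sg_gen x.
Proof. by case: b => //; rewrite [RHS]sg_invE. Qed.

Lemma cls_cons l u : cls (l :: u) = cls [:: l] * cls u.
Proof. by rewrite [RHS]sg_mulE. Qed.

Lemma sg_ind (P : structGroup -> Prop) : P 1 ->
  (forall g x, P g -> P (g * sg_gen x)) ->
  (forall g x, P g -> P (g * (sg_gen x)^-1)) -> forall g, P g.
Proof.
move=> P1 Pp Pn g; case: (cls_surj g) => u {g} ->.
elim/last_ind: u => // u [x b] IH.
rewrite -cats1 -[cls _]sg_mulE cls_letter.
by case: b; [exact: Pn|exact: Pp].
Qed.

Section Lift.
Variables (H : groupType) (f : S -> H).
Hypothesis f_rel : forall x y : S,
  f x * f y = f (sigma (@sol_map S) x y) * f (gamma (@sol_map S) y x).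

Definition lift_letter (l : {classic S} * bool) : H :=
  if l.2 then (f l.1)^-1 else f l.1.

Definition lift_word (u : word) : H := \prod_(l <- u) lift_letter l.

Lemma lift_word_cat u v : lift_word (u ++ v) = lift_word u * lift_word v.
Proof. by rewrite /lift_word big_cat. Qed.

Lemma lift_word_equiv u v : word_equiv u v -> lift_word u = lift_word v.
Proof.
elim=> {u v} // [u v w _ -> _ ->|u u' v v' _ E _ E'|x b|x y] //.
- by rewrite !lift_word_cat E E'.
- rewrite /lift_word !big_cons big_nil mulg1 /lift_letter /=.
  by case: b; rewrite /= ?mulgV ?mulVg.
- by rewrite /lift_word !big_cons big_nil !mulg1 /lift_letter /= f_rel.
Qed.

Definition sg_lift (g : structGroup) : H := lift_word (repr g).

Lemma sg_lift_cls u : sg_lift (cls u) = lift_word u.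
Proof. exact/lift_word_equiv/repr_cls. Qed.

Lemma sg_lift_gen x : sg_lift (sg_gen x) = f x.
Proof. by rewrite sg_lift_cls /lift_word big_cons big_nil mulg1. Qed.

Lemma sg_liftM : {morph sg_lift : g h / g * h >-> g * h}.
Proof.
move=> g h; case: (cls_surj g) (cls_surj h) => u -> [v ->].
by rewrite [X in sg_lift X]sg_mulE !sg_lift_cls lift_word_cat.
Qed.

End Lift.

End StructureGroup.

Definition freeab (X : Type) := {freeg {classic X} / int}.
HB.instance Definition _ X := GRing.Zmodule.on (freeab X).

Section FreeAb.
Variable X : Type.
Implicit Types (p q : sym X) (a b : freeab X).

Definition fgen (x : X) : freeab X := << (x : {classic X}) >>.

Definition fext (M : zmodType) (f : X -> M) (a : freeab X) : M :=
  fglift (f : {classic X} -> zmodule M) a.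

Lemma fextB (M : zmodType) (f : X -> M) a b :
  fext f (a - b)%R = (fext f a - fext f b)%R.
Proof. exact: (@lift_is_additive int {classic X} (zmodule M)). Qed.

Lemma fext0 (M : zmodType) (f : X -> M) : fext f 0%R = 0%R.
Proof. by have := fextB f 0%R 0%R; rewrite !subrr. Qed.

Lemma fextN (M : zmodType) (f : X -> M) a : fext f (- a)%R = (- fext f a)%R.
Proof. by rewrite -[X in fext f X]add0r fextB fext0 add0r. Qed.

Lemma fextD (M : zmodType) (f : X -> M) a b :
  fext f (a + b)%R = (fext f a + fext f b)%R.
Proof. by rewrite -{1}(opprK b) fextB fextN opprK. Qed.

Lemma fext_gen (M : zmodType) (f : X -> M) x : fext f (fgen x) = f x.
Proof. by rewrite /fext liftU scale1r. Qed.

Lemma freeab_ind (P : freeab X -> Prop) : P 0%R ->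
  (forall x a, P a -> P (a + fgen x)%R) ->
  (forall x a, P a -> P (a - fgen x)%R) -> forall a, P a.
Proof.
move=> P0 Pp Pn a; rewrite -(freeg_sumE a); elim: (dom a) => [|x s].
  by rewrite big_nil.
rewrite big_cons addrC; set b := (\sum_(_ <- _) _)%R => Pb.
have E (n : nat) : <<n%:Z *g x>>%R = (fgen x *+ n)%R.
  by rewrite [RHS]freegU_muln pmulrn intz.
case: (coeff x a) => n.
  rewrite E; elim: n => [|n IH]; first by rewrite mulr0n addr0.
  by rewrite mulrSr addrA; exact: Pp.
rewrite NegzE -freegUN E; elim: n.+1 => [|m IH]; first by rewrite mulr0n subr0.
by rewrite mulrSr opprD addrA; exact: Pn.
Qed.

Definition fperm (p : sym X) : freeab X -> freeab X := fext (fgen \o p).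

Lemma fperm_gen p x : fperm p (fgen x) = fgen (p x).
Proof. by rewrite /fperm fext_gen. Qed.

Lemma fpermD p a b : fperm p (a + b)%R = (fperm p a + fperm p b)%R.
Proof. exact: fextD. Qed.

Lemma fpermN p a : fperm p (- a)%R = (- fperm p a)%R.
Proof. exact: fextN. Qed.

Lemma fperm1 a : fperm 1 a = a.
Proof.
elim/freeab_ind: a => [|x a IH|x a IH]; first exact: fext0.
  by rewrite fpermD IH fperm_gen.
by rewrite fpermD fpermN IH fperm_gen.
Qed.

Lemma fpermM p q a : fperm (p * q) a = fperm p (fperm q a).
Proof.
elim/freeab_ind: a => [|x a IH|x a IH]; first by rewrite /fperm !fext0.
  by rewrite !fpermD IH !fperm_gen.
by rewrite !fpermD !fpermN IH !fperm_gen.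
Qed.

Lemma fpermK p a : fperm p^-1 (fperm p a) = a.
Proof. by rewrite -fpermM mulVg fperm1. Qed.

Lemma fpermVK p a : fperm p (fperm p^-1 a) = a.
Proof. by rewrite -fpermM mulgV fperm1. Qed.

End FreeAb.

Arguments fperm {X} p%_g a%_R.

Record semidirect (X : Type) := SemiDirect {
  sd_ab : freeab X;
  sd_sym : sym X
}.

HB.instance Definition _ (X : Type) := gen_eqMixin (semidirect X).
HB.instance Definition _ (X : Type) := gen_choiceMixin (semidirect X).

Section SemiDirectGroup.
Variable X : Type.
Implicit Types u v w : semidirect X.

Definition sd_one : semidirect X := SemiDirect 0%R 1.
Definition sd_mul u v : semidirect X :=
  SemiDirect (sd_ab u + fperm (sd_sym u) (sd_ab v))%R (sd_sym u * sd_sym v).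
Definition sd_inv u : semidirect X :=
  SemiDirect (- fperm (sd_sym u)^-1 (sd_ab u))%R (sd_sym u)^-1.

Lemma sd_mulA : associative sd_mul.
Proof.
by move=> u v w; rewrite /sd_mul /= fpermD fpermM addrA mulgA.
Qed.

Lemma sd_mul1 : left_id sd_one sd_mul.
Proof. by case=> a p; rewrite /sd_mul /= fperm1 add0r mul1g. Qed.

Lemma sd_mulr1 : right_id sd_one sd_mul.
Proof. by case=> a p; rewrite /sd_mul /= /fperm fext0 addr0 mulg1. Qed.

Lemma sd_mulV : left_inverse sd_one sd_inv sd_mul.
Proof. by case=> a p; rewrite /sd_mul /sd_inv /= addNr mulVg. Qed.

Lemma sd_mulrV : right_inverse sd_one sd_inv sd_mul.
Proof.
by case=> a p; rewrite /sd_mul /sd_inv /= fpermN fpermVK subrr mulgV.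
Qed.

HB.instance Definition _ := isGroup.Build (semidirect X)
  sd_mulA sd_mul1 sd_mulr1 sd_mulV sd_mulrV.

End SemiDirectGroup.

Section PiPhi.
Variable S : solution.
Implicit Types (x y : S) (g h k : structGroup S).

Definition piphi : structGroup S -> semidirect S :=
  sg_lift (fun x => SemiDirect (fgen x) (sigp x)).

Definition pi g : freeab S := sd_ab (piphi g).
Definition phi g : sym S := sd_sym (piphi g).

Lemma piphi_rel x y :
  SemiDirect (fgen x) (sigp x) * SemiDirect (fgen y) (sigp y) =
  SemiDirect (fgen (sigma (@sol_map S) x y)) (sigp (sigma (@sol_map S) x y)) *
  SemiDirect (fgen (gamma (@sol_map S) y x)) (sigp (gamma (@sol_map S) y x)).
Proof.
rewrite -!sigpE [LHS]/(sd_mul _ _) [RHS]/(sd_mul _ _) /sd_mul /= !fperm_gen.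
by rewrite (sol_invo x y).1 sigpM addrC.
Qed.

Lemma piphi_gen x : piphi (sg_gen x) = SemiDirect (fgen x) (sigp x).
Proof. exact: (sg_lift_gen piphi_rel). Qed.

Lemma piphiM : {morph piphi : g h / g * h >-> g * h}.
Proof. exact: (sg_liftM piphi_rel). Qed.

Lemma pi_gen x : pi (sg_gen x) = fgen x.
Proof. by rewrite /pi piphi_gen. Qed.

Lemma phi_gen x : phi (sg_gen x) = sigp x.
Proof. by rewrite /phi piphi_gen. Qed.

Lemma piM g h : pi (g * h) = (pi g + fperm (phi g) (pi h))%R.
Proof. by rewrite /pi piphiM. Qed.

Lemma phiM g h : phi (g * h) = phi g * phi h.
Proof. by rewrite /phi piphiM. Qed.

Lemma phi1 : phi 1 = 1.
Proof. by apply: (mulgI (phi 1)); rewrite -phiM !mulg1. Qed.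

Lemma phiV g : phi g^-1 = (phi g)^-1.
Proof. by apply: (mulgI (phi g)); rewrite -phiM !mulgV phi1. Qed.

Lemma pi1 : pi 1 = 0%R.
Proof.
by apply: (addrI (pi 1)); rewrite addr0 -{2}(fperm1 (pi 1)) -phi1 -piM mulg1.
Qed.

Lemma piV g : pi g^-1 = (- fperm (phi g)^-1 (pi g))%R.
Proof.
by apply: (addIr (fperm (phi g^-1) (pi g))); rewrite -piM mulVg pi1 phiV addNr.
Qed.

(* g |-> x + g in the additive group of G(X,r), see pi_shift *)
Definition shift x g := g * sg_gen ((phi g)^-1 x).
Definition diagV (y : S) : S := sval (cid (diag_surj y)).
Lemma diagVK y : diag (diagV y) = y.
Proof. by rewrite /diagV; case: cid. Qed.
Lemma diagK y : diagV (diag y) = y.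
Proof. by apply: diag_inj; rewrite diagVK. Qed.
Definition unshift x g := g * (sg_gen (diagV ((phi g)^-1 x)))^-1.

Lemma shiftK x : cancel (shift x) (unshift x).
Proof.
move=> g; rewrite /unshift /shift phiM phi_gen invgM symME.
by rewrite -/(diag _) diagK mulgK.
Qed.

Lemma unshiftK x : cancel (unshift x) (shift x).
Proof.
move=> g; rewrite /unshift /shift phiM phiV phi_gen invgM invgK symME.
set z := diagV _; have -> : (phi g)^-1 x = diag z by rewrite diagVK.
by rewrite /diag symgVK mulgVK.
Qed.

Definition shifts x : sym (structGroup S) := Sym (shiftK x) (unshiftK x).

Lemma shiftsC x y : shifts x * shifts y = shifts y * shifts x.
Proof.
apply: symP => g; rewrite !symME /= /shift -!mulgA.
rewrite !phiM !phi_gen !invgM !symME.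
set u := (phi g)^-1 x; set v := (phi g)^-1 y.
congr (g * _); rewrite sg_relP -sigpE symgVK; congr (_ * sg_gen _).
by rewrite -[LHS]/(gamma _ _ v) gamE symgVK.
Qed.

Definition bicentral (p : sym (structGroup S)) : Prop :=
  forall q, (forall x, q * shifts x = shifts x * q) -> p * q = q * p.

Definition translation := {p : sym (structGroup S) | bicentral p}.
HB.instance Definition _ := gen_eqMixin translation.
HB.instance Definition _ := gen_choiceMixin translation.

Lemma bicentral_shifts x : bicentral (shifts x).
Proof. by move=> q ->. Qed.
Lemma bicentral1 : bicentral 1.
Proof. by move=> q _; rewrite mulg1 mul1g. Qed.
Lemma bicentralM p q : bicentral p -> bicentral q -> bicentral (p * q).
Proof.
move=> hp hq s hs; transitivity (p * (s * q)); first by rewrite -(hq s hs) mulgA.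
by rewrite mulgA (hp s hs) mulgA.
Qed.
Lemma bicentralV p : bicentral p -> bicentral p^-1.
Proof.
move=> hp s hs; apply: (mulgI p); rewrite mulgA mulgV mul1g.
by rewrite mulgA hp // mulgK.
Qed.

Definition tr_zero : translation := exist _ _ bicentral1.
Definition tr_add (p q : translation) : translation :=
  exist _ _ (bicentralM (svalP p) (svalP q)).
Definition tr_opp (p : translation) : translation :=
  exist _ _ (bicentralV (svalP p)).

Lemma trP (p q : translation) : sval p = sval q -> p = q.
Proof. exact: eq_sig_hprop => ? ? ?; exact: Prop_irrelevance. Qed.

Lemma tr_addA : associative tr_add.
Proof. by move=> p q r; apply: trP; rewrite /= mulgA. Qed.
Lemma tr_addC : commutative tr_add.
Proof.
move=> p q; apply: trP => /=; apply: (svalP p) => x.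
by rewrite (svalP q) // => y; rewrite shiftsC.
Qed.
Lemma tr_add0 : left_id tr_zero tr_add.
Proof. by move=> p; apply: trP; rewrite /= mul1g. Qed.
Lemma tr_addN : left_inverse tr_zero tr_opp tr_add.
Proof. by move=> p; apply: trP; rewrite /= mulVg. Qed.

HB.instance Definition _ := GRing.isZmodule.Build translation
  tr_addA tr_addC tr_add0 tr_addN.

Definition translate (a : freeab S) : sym (structGroup S) :=
  sval (fext (fun x => exist _ _ (bicentral_shifts x) : translation) a).

Lemma translateDl a b g : translate (a + b)%R g = translate a (translate b g).
Proof. by rewrite /translate fextD. Qed.
Lemma translate_gen x g : translate (fgen x) g = shift x g.
Proof. by rewrite /translate fext_gen. Qed.
Lemma translate_genN x g : translate (- fgen x)%R g = unshift x g.
Proof. by rewrite /translate fextN fext_gen. Qed.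

Definition pi_inv (a : freeab S) : structGroup S := translate a 1.

Lemma piK : cancel pi pi_inv.
Proof.
move=> g; rewrite /pi_inv; elim/sg_ind: g => [|g x IH|g x IH].
- by rewrite pi1 /translate fext0.
- rewrite piM pi_gen fperm_gen addrC translateDl IH translate_gen.
  by rewrite /shift symgK.
- rewrite piM piV phi_gen pi_gen fpermN !fperm_gen addrC translateDl IH.
  by rewrite translate_genN /unshift symgK -/(diag _) diagK.
Qed.

Lemma pi_shift x g : pi (shift x g) = (pi g + fgen x)%R.
Proof. by rewrite piM pi_gen fperm_gen symgVK. Qed.

Lemma pi_invK : cancel pi_inv pi.
Proof.
elim/freeab_ind=> [|x a IH|x a IH]; rewrite /pi_inv.
- by rewrite /translate fext0 pi1.
- by rewrite addrC translateDl translate_gen pi_shift IH addrC.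
- rewrite addrC translateDl translate_genN; apply: (addIr (fgen x)).
  by rewrite -pi_shift unshiftK IH addrAC addNr add0r.
Qed.

Lemma pi_inj : injective pi. Proof. exact: can_inj piK. Qed.

Lemma pi_bij : bijective pi. Proof. exact: Bijective piK pi_invK. Qed.

Definition sg_add g h : structGroup S := pi_inv (pi g + pi h)%R.
Definition sg_opp g : structGroup S := pi_inv (- pi g)%R.
Definition sg_zero : structGroup S := pi_inv 0%R.

Lemma sg_addA : associative sg_add.
Proof. by move=> g h k; rewrite /sg_add !pi_invK addrA. Qed.
Lemma sg_addC : commutative sg_add.
Proof. by move=> g h; rewrite /sg_add addrC. Qed.
Lemma sg_add0 : left_id sg_zero sg_add.
Proof. by move=> g; rewrite /sg_add pi_invK add0r piK. Qed.
Lemma sg_addN : left_inverse sg_zero sg_opp sg_add.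
Proof. by move=> g; rewrite /sg_add pi_invK addNr. Qed.

HB.instance Definition _ := GRing.isZmodule.Build (structGroup S)
  sg_addA sg_addC sg_add0 sg_addN.

Lemma sg_addE g h : (g + h)%R = pi_inv (pi g + pi h)%R. Proof. by []. Qed.

Lemma piD g h : pi (g + h)%R = (pi g + pi h)%R.
Proof. exact: pi_invK. Qed.

Lemma sg_braceP g h k :
  ((g * (h + k)%R)%g + g = (g * h)%g + (g * k)%g)%R.
Proof. by apply: pi_inj; rewrite !piD !piM piD fpermD addrAC addrACA. Qed.

HB.instance Definition _ := isLeftBrace.Build (structGroup S) sg_braceP.

Lemma sg_addEM g h : (g + h)%R = g * pi_inv (fperm (phi g)^-1 (pi h)).
Proof. by apply: pi_inj; rewrite piD piM pi_invK fpermVK. Qed.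

Lemma phiD_wd g g' h h' :
  phi g = phi g' -> phi h = phi h' -> phi (g + h)%R = phi (g' + h')%R.
Proof.
have wd a b c : phi a = phi b -> phi (a + c)%R = phi (b + c)%R.
  by move=> E; rewrite !sg_addEM !phiM E.
move=> Eg Eh; rewrite (wd g g' h Eg) (addrC g' h) (addrC g' h').
exact: wd.
Qed.

Definition permGroup := {p : sym S | exists g, phi g = p}.
HB.instance Definition _ := gen_eqMixin permGroup.
HB.instance Definition _ := gen_choiceMixin permGroup.

Definition pg_phi g : permGroup := exist _ (phi g) (ex_intro _ g erefl).

Lemma pgP (p q : permGroup) : sval p = sval q -> p = q.
Proof. exact: eq_sig_hprop => ? ? ?; exact: Prop_irrelevance. Qed.

Definition pg_lift (p : permGroup) : structGroup S := sval (cid (svalP p)).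

Lemma pg_liftK : cancel pg_lift pg_phi.
Proof. by move=> p; apply: pgP; rewrite /= /pg_lift; case: cid. Qed.

Lemma permGroup1 : exists g, phi g = 1. Proof. by exists 1; exact: phi1. Qed.
Lemma permGroupM (p q : permGroup) : exists g, phi g = sval p * sval q.
Proof.
by case: (svalP p) (svalP q) => g <- [h <-]; exists (g * h); rewrite phiM.
Qed.
Lemma permGroupV (p : permGroup) : exists g, phi g = (sval p)^-1.
Proof. by case: (svalP p) => g <-; exists g^-1; rewrite phiV. Qed.

Definition pg_one : permGroup := exist _ 1 permGroup1.
Definition pg_mul (p q : permGroup) : permGroup :=
  exist _ (sval p * sval q) (permGroupM p q).
Definition pg_inv (p : permGroup) : permGroup :=
  exist _ (sval p)^-1 (permGroupV p).

Lemma pg_mulA : associative pg_mul.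
Proof. by move=> p q r; apply: pgP; exact: mulgA. Qed.
Lemma pg_mul1 : left_id pg_one pg_mul.
Proof. by move=> p; apply: pgP; exact: mul1g. Qed.
Lemma pg_mulr1 : right_id pg_one pg_mul.
Proof. by move=> p; apply: pgP; exact: mulg1. Qed.
Lemma pg_mulV : left_inverse pg_one pg_inv pg_mul.
Proof. by move=> p; apply: pgP; exact: mulVg. Qed.
Lemma pg_mulrV : right_inverse pg_one pg_inv pg_mul.
Proof. by move=> p; apply: pgP; exact: mulgV. Qed.

HB.instance Definition _ := isGroup.Build permGroup
  pg_mulA pg_mul1 pg_mulr1 pg_mulV pg_mulrV.

(* by phiD_wd the choice of preimages made by pg_lift is irrelevant: pg_phiD *)
Definition pg_add (p q : permGroup) : permGroup :=
  pg_phi (pg_lift p + pg_lift q)%R.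
Definition pg_zero : permGroup := pg_phi 0%R.
Definition pg_opp (p : permGroup) : permGroup := pg_phi (- pg_lift p)%R.

Lemma pg_addE g h : pg_add (pg_phi g) (pg_phi h) = pg_phi (g + h)%R.
Proof.
by apply: pgP => /=; apply: phiD_wd; exact: (congr1 sval (pg_liftK (pg_phi _))).
Qed.

Lemma pg_addA : associative pg_add.
Proof.
move=> p q r; rewrite -(pg_liftK p) -(pg_liftK q) -(pg_liftK r) !pg_addE.
by rewrite addrA.
Qed.
Lemma pg_addC : commutative pg_add.
Proof. by move=> p q; rewrite /pg_add addrC. Qed.
Lemma pg_add0 : left_id pg_zero pg_add.
Proof. by move=> p; rewrite -(pg_liftK p) pg_addE add0r. Qed.
Lemma pg_addN : left_inverse pg_zero pg_opp pg_add.
Proof. by move=> p; rewrite -{2}(pg_liftK p) pg_addE addNr. Qed.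

HB.instance Definition _ := GRing.isZmodule.Build permGroup
  pg_addA pg_addC pg_add0 pg_addN.

Lemma pg_phiD g h : (pg_phi g + pg_phi h)%R = pg_phi (g + h)%R.
Proof. exact: pg_addE. Qed.

Lemma pg_phiM g h : pg_phi g * pg_phi h = pg_phi (g * h).
Proof. by apply: pgP; rewrite /= phiM. Qed.

Lemma pg_braceP (p q r : permGroup) :
  ((p * (q + r)%R)%g + p = (p * q)%g + (p * r)%g)%R.
Proof.
rewrite -(pg_liftK p) -(pg_liftK q) -(pg_liftK r).
by rewrite !(pg_phiD, pg_phiM) braceP.
Qed.

HB.instance Definition _ := isLeftBrace.Build permGroup pg_braceP.

End PiPhi.

Local Open Scope classical_set_scope.

Section CosetSolution.
Variable G : leftBraceType.
Implicit Types (g h y z : G) (K : set G).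

Definition lam g y : G := ((g * y)%g - g)%R.

Lemma lamB g y z : lam g (y - z)%R = (lam g y - lam g z)%R.
Proof.
have E : ((g * (y - z)%R)%g = (g * y)%g + g - (g * z)%g :> G)%R.
  by have := braceP g (y - z)%R z; rewrite subrK => ->; rewrite addrK.
by rewrite /lam E addrAC addrK opprB addrA subrK.
Qed.

Lemma lamM g h y : lam (g * h)%g y = lam g (lam h y).
Proof.
by rewrite {3}/lam lamB /lam mulgA opprB addrA subrK.
Qed.

Definition lam_orbit y : set G := [set lam g y | g in setT].
Definition lam_stab y : set G := [set g | lam g y = y].

Definition lcoset g K : set G := [set (g * k)%g | k in K].
Definition core K : set G := \bigcap_g [set (g * k * g^-1)%g | k in K].

Definition add_generates (X : set G) : Prop :=
  smallest (fun A : set G => zmod_closed [in A]) X = setT.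

Lemma lcosetM g h K : lcoset g (lcoset h K) = lcoset (g * h)%g K.
Proof.
apply/seteqP; split=> z.
  by case=> _ [k Kk <-] <-; exists k => //; rewrite mulgA.
by case=> k Kk <-; exists (h * k)%g; [exists k|rewrite mulgA].
Qed.

Lemma lcoset1 K : lcoset 1%g K = K.
Proof. by rewrite /lcoset; under eq_imagel do rewrite mul1g; exact: image_id. Qed.

Record coset_data (X : set G) (I : Type) (Xi : I -> set G) (x : I -> G)
    (J : I -> Type) (K : forall i, J i -> set G) : Prop := CosetData {
  cd_invariant : forall g y, X y -> X (lam g y);
  cd_generates : add_generates X;
  cd_cover : X = \bigcup_i Xi i;
  cd_disjoint : trivIset setT Xi;
  cd_orbit : forall i, exists y, Xi i = lam_orbit y;
  cd_base : forall i, Xi i (x i);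
  cd_nonempty : forall i, inhabited (J i);
  cd_subgroup : forall i j, group_closed [in K i j];
  cd_stab : forall i j, K i j `<=` lam_stab (x i);
  cd_core : \bigcap_i \bigcap_j core (K i j) = [set 1%g]
}.

Section Map.
Variables (I : Type) (x : I -> G) (J : I -> Type) (K : forall i, J i -> set G).

Definition cosets (H : set G) : Type := {C : set G | exists g, C = lcoset g H}.

Definition coset_union : Type := {i : I & {j : J i & cosets (K j)}}.

Definition mk_coset (i : I) (j : J i) (g : G) : coset_union :=
  existT _ i (existT _ j (exist _ (lcoset g (K j)) (ex_intro _ g erefl))).

Definition coset_idx (y : coset_union) : I := projT1 y.
Definition coset_repr (y : coset_union) : G :=
  sval (cid (svalP (projT2 (projT2 y)))).

Lemma cosets_mul (H : set G) (a : G) (C : cosets H) :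
  exists g, lcoset a (sval C) = lcoset g H.
Proof. by case: (svalP C) => g ->; exists (a * g)%g; rewrite lcosetM. Qed.

Definition coset_trans (a : G) (y : coset_union) : coset_union :=
  let: existT i (existT j C) := y in
  existT _ i (existT _ j (exist _ (lcoset a (sval C)) (cosets_mul a C))).

Lemma coset_union_eq i (j : J i) (C D : cosets (K j)) : sval C = sval D ->
  existT _ i (existT _ j C) = existT _ i (existT _ j D) :> coset_union.
Proof.
move=> E; congr existT; congr existT.
by apply: eq_sig_hprop E => ? ? ?; exact: Prop_irrelevance.
Qed.

Lemma coset_transM a b (y : coset_union) :
  coset_trans a (coset_trans b y) = coset_trans (a * b)%g y.
Proof. by case: y => i [j C]; apply: coset_union_eq; rewrite /= lcosetM. Qed.

Lemma coset_trans1 (y : coset_union) : coset_trans 1%g y = y.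
Proof. by case: y => i [j C]; apply: coset_union_eq; rewrite /= lcoset1. Qed.

Lemma coset_trans_mk a i (j : J i) g :
  coset_trans a (mk_coset j g) = mk_coset j (a * g)%g.
Proof. by apply: coset_union_eq; rewrite /= lcosetM. Qed.

Lemma coset_transK a : cancel (coset_trans a) (coset_trans a^-1%g).
Proof. by move=> y; rewrite coset_transM mulVg coset_trans1. Qed.

Lemma coset_transVK a : cancel (coset_trans a^-1%g) (coset_trans a).
Proof. by move=> y; rewrite coset_transM mulgV coset_trans1. Qed.

(* the permutation z |-> lam_g(x_i) z attached to y = gK_{i,j}; when K_{i,j}
   stabilizes x_i it does not depend on the representative g, see coset_permE *)
Definition coset_perm (y : coset_union) : sym coset_union :=
  let a := lam (coset_repr y) (x (coset_idx y)) in
  Sym (coset_transK a) (coset_transVK a).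

Definition coset_map (p : coset_union * coset_union) :
    coset_union * coset_union :=
  let z := coset_perm p.1 p.2 in (z, (coset_perm z)^-1%g p.1).

Lemma coset_permE i1 (j1 : J i1) g1 i2 (j2 : J i2) g2 :
  group_closed [in K j1] -> K j1 `<=` lam_stab (x i1) ->
  coset_perm (mk_coset j1 g1) (mk_coset j2 g2) =
  mk_coset j2 (lam g1 (x i1) * g2)%g.
Proof.
case=> K1 _ Kst; rewrite -[LHS]/(coset_trans _ (mk_coset j2 g2)) coset_trans_mk.
congr mk_coset.
congr (_ * _)%g; rewrite /coset_repr; case: cid => h /= E.
have : lcoset h (K j1) h by exists 1%g; [exact: set_mem|exact: mulg1].
by rewrite -E => -[k /Kst hk <-]; rewrite lamM hk.
Qed.

Lemma coset_mapE i1 (j1 : J i1) g1 i2 (j2 : J i2) g2 :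
  group_closed [in K j1] -> K j1 `<=` lam_stab (x i1) ->
  coset_map (mk_coset j1 g1, mk_coset j2 g2) =
  let z := mk_coset j2 (lam g1 (x i1) * g2)%g in
  (z, (coset_perm z)^-1%g (mk_coset j1 g1)).
Proof. by move=> Kg Kst; rewrite /coset_map coset_permE. Qed.

End Map.

End CosetSolution.

Arguments mk_coset {G I J} K {i} j g.
Arguments coset_perm {G I} x {J} K y.
Arguments coset_map {G I} x {J} K p.

(* Main.v *)
(* Both halves rest on one construction: a set Y with an action of (G, .) and a
   map lab : Y -> G such that lab (g y) = lambda_g (lab y). The map
   s(y, z) = (lab(y) z, lab(lab(y) z)^-1 y) is then a solution, and lab extends
   to a brace morphism from the structure group to G through which the
   permutation representation factors; if the action is faithful and lab(Y)
   generates (G, +), the permutation brace is therefore G.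
   For cosets take lab(g K_ij) = lambda_g(x_i); the core condition is
   faithfulness. Conversely, an isomorphism F from the permutation brace of Z to
   G makes Z such a labelled G-set, with lab(z) = F(sigma_z), and decomposing Z
   into orbits G/K with K the stabilizer of a point gives the coset form. *)
Require Import Defs.
From mathcomp Require Import all_boot all_algebra.
From mathcomp Require Import boolp classical_sets.

Set Implicit Arguments.
Unset Strict Implicit.
Unset Printing Implicit Defensive.

Import GRing.Theory.

Local Open Scope group_scope.
Local Open Scope classical_set_scope.

Lemma inj_surj_bijective (A B : Type) (f : A -> B) :
  injective f -> (forall b, exists a, f a = b) -> bijective f.
Proof. by move=> finj /choice[g gK]; exists g => // a; exact/finj/gK. Qed.

(** * Arithmetic of [lam] in a left brace *)

Section Brace.
Variable G : leftBraceType.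
Implicit Types g h y z : G.

Lemma brace_mulE g h : g * h = (g + lam g h)%R.
Proof. by rewrite /lam addrC subrK. Qed.

Lemma brace_10 : (1 : G) = 0%R.
Proof.
have /(congr1 (fun t => t - (1 * 0)%g)%R) := braceP (1 : G) 0%R 0%R.
by rewrite addr0 addrK addrAC subrr add0r mul1g.
Qed.

Lemma lam1 y : lam 1 y = y.
Proof. by rewrite /lam mul1g brace_10 subr0. Qed.

Lemma lamg0 g : lam g 0%R = 0%R.
Proof. by rewrite /lam -brace_10 mulg1 brace_10 subrr. Qed.

Lemma lamD g y z : lam g (y + z)%R = (lam g y + lam g z)%R.
Proof. by rewrite -{1}[z]opprK lamB -(sub0r z) lamB lamg0 sub0r opprK. Qed.

Lemma lamVK g : cancel (lam g^-1) (lam g).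
Proof. by move=> y; rewrite -lamM mulgV lam1. Qed.

(* both sides are g + h *)
Lemma lam_mul_lamV g h :
  lam g h * lam (lam g h)^-1 g = g * h.
Proof. by rewrite !brace_mulE lamVK addrC. Qed.

(** Written as sums, both sides are [lam g h + lam (g * h) k]. This is the cocycle rule behind
    [label_gammaM]. *)
Lemma lam_mul_split g h k :
  lam g (h * k) = lam g h * lam (lam (lam g h)^-1 g) k.
Proof.
by rewrite [RHS]brace_mulE -lamM lam_mul_lamV lamM -lamD -brace_mulE.
Qed.

Lemma lam_orbit_refl y : lam_orbit y y.
Proof. by exists 1; rewrite ?lam1. Qed.

Lemma lam_orbit_eq y z : lam_orbit y z -> lam_orbit z = lam_orbit y.
Proof.
case=> g _ <-; apply/seteqP; split=> _ [h _ <-].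
  by exists (h * g); rewrite ?lamM.
by exists (h * g^-1); rewrite // -lamM mulgVK.
Qed.

End Brace.

(** * Solutions from labelled group actions *)

Section LabelledAction.
Variables (G : leftBraceType) (Y : Type) (act : G -> sym Y) (lab : Y -> G).
Hypothesis actM : forall g h, act (g * h) = act g * act h.
Hypothesis lab_act : forall g y, lab (act g y) = lam g (lab y).

Definition label_map (p : Y * Y) : Y * Y :=
  let z := act (lab p.1) p.2 in (z, (act (lab z))^-1 p.1).

Lemma act1 : act 1 = 1.
Proof. by apply: (mulgI (act 1)); rewrite -actM !mulg1. Qed.

Lemma actV g : act g^-1 = (act g)^-1.
Proof. by apply: (mulgI (act g)); rewrite -actM !mulgV act1. Qed.

(* The second component of label_map depends on z only through lab z; replacing
   lab z by any element of G makes it a right action of the group G on Y, whence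
   its bijectivity. *)
Definition label_gamma (c : G) (y : Y) : Y := act (lam (lab y) c)^-1 y.

Lemma label_mapE y z :
  label_map (y, z) = (act (lab y) z, label_gamma (lab z) y).
Proof. by rewrite /label_map /label_gamma /= lab_act actV. Qed.

Lemma r12_label x y z :
  r12 label_map (x, y, z) = (act (lab x) y, label_gamma (lab y) x, z).
Proof. by rewrite /r12 label_mapE. Qed.

Lemma r23_label x y z :
  r23 label_map (x, y, z) = (x, act (lab y) z, label_gamma (lab z) y).
Proof. by rewrite /r23 label_mapE. Qed.

(** For [c = lab z] this says that [label_map] preserves the product of the two labels; the outer
    components of the braid relation and [label_rel] rest on it. *)
Lemma lab_gamma c y : lab y * c = lam (lab y) c * lab (label_gamma c y).
Proof. by rewrite lab_act lam_mul_lamV. Qed.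

Lemma label_gammaM b c y :
  label_gamma c (label_gamma b y) = label_gamma (b * c) y.
Proof. by rewrite /label_gamma lab_act -symME -actM -invgM -lam_mul_split. Qed.

Lemma label_gammaK c : cancel (label_gamma c) (label_gamma c^-1).
Proof.
move=> y; rewrite label_gammaM mulgV /label_gamma brace_10 lamg0.
by rewrite -brace_10 invg1 act1.
Qed.

Lemma label_map_solution : is_solution label_map.
Proof.
split.
- move=> [[x y] z]; rewrite !(r12_label, r23_label); congr (_, _, _).
  + by rewrite -!symME -!actM lab_act -lab_gamma.
  (* Middle component: both sides are translates of [y]. Multiplying the translating elements by
     [lam (lab x * lab y) (lab z)] leaves [lam_mul_lamV] for [lab x] and [lam (lab y) (lab z)]. *)
  + rewrite /label_gamma !lab_act -!symME -!actM -!lamM lam_mul_lamV.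
    congr (act _ y); apply: (mulgI (lam (lab x * lab y) (lab z))).
    by rewrite mulgA mulgV mul1g mulgA (lamM (lab x)) lam_mul_lamV mulgK.
  + by rewrite !label_gammaM lab_act -lab_gamma.
- by case=> y z; rewrite /label_map /= symVK symK.
- move=> x; exists (sym_inv (act (lab x))) => y;
    by rewrite /sigma /= ?symK ?symVK.
- move=> y; exists (label_gamma (lab y)^-1) => x; rewrite /gamma label_mapE /=.
    exact: label_gammaK.
  by rewrite -{1}(invgK (lab y)) label_gammaK.
Qed.

(** * The permutation brace of a labelled action *)

Hypothesis act_faithful : forall g, act g = 1 -> g = 1.
Hypothesis lab_generates : add_generates (range lab).

Variable hs : is_solution label_map.
Let S := Solution hs.

Lemma sigp_label (y : S) : sigp y = act (lab y).
Proof. by apply: symP => z; rewrite sigpE. Qed.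

Lemma label_rel (x y : S) :
  lab x * lab y = lab (sigma (@sol_map S) x y) * lab (gamma (@sol_map S) y x).
Proof. by rewrite /gamma /sigma [sol_map _]label_mapE lab_act -lab_gamma. Qed.

Definition eval_label : structGroup S -> G := sg_lift (lab : S -> G).

Lemma eval_labelM : {morph eval_label : g h / g * h >-> g * h}.
Proof. exact: sg_liftM label_rel. Qed.

Lemma eval_label_gen (x : S) : eval_label (sg_gen x) = lab x.
Proof. exact: sg_lift_gen label_rel x. Qed.

Lemma phi_eval_label g : phi g = act (eval_label g).
Proof.
elim/sg_ind: g => [|g x IH|g x IH].
- rewrite phi1 -act1; congr (act _).
  by apply: (mulgI (eval_label 1)); rewrite -eval_labelM !mulg1.
- by rewrite phiM phi_gen eval_labelM eval_label_gen actM sigp_label IH.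
- apply: (mulIg (phi (sg_gen x))); rewrite -phiM mulgVK IH phi_gen sigp_label.
  by rewrite -actM -(eval_label_gen x) -eval_labelM mulgVK.
Qed.

(* Additivity of eval_label: it factors through pi as the additive extension of
   lab. *)
Lemma eval_label_pi g : eval_label g = fext (lab : S -> G) (Defs.pi g).
Proof.
have step h (x : S) : eval_label (h * sg_gen x) =
    (eval_label h + lab (phi h x))%R.
  by rewrite eval_labelM eval_label_gen brace_mulE phi_eval_label lab_act.
have pi_step h (x : S) :
    Defs.pi (h * sg_gen x) = (Defs.pi h + fgen (phi h x))%R.
  by rewrite piM pi_gen fperm_gen.
elim/sg_ind: g => [|g x IH|g x IH].
- rewrite pi1 fext0 -brace_10.
  by apply: (mulgI (eval_label 1)); rewrite -eval_labelM !mulg1.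
- by rewrite step pi_step fextD fext_gen IH.
- set h := g * _ in IH *; have gE : g = h * sg_gen x by rewrite mulgVK.
  by move: IH; rewrite gE step pi_step fextD fext_gen => /addIr.
Qed.

Lemma eval_labelD g h : eval_label (g + h)%R = (eval_label g + eval_label h)%R.
Proof. by rewrite !eval_label_pi piD fextD. Qed.

(** The image is an additive subgroup containing every label, hence contains the subgroup they
    generate, which is all of [G]. *)
Lemma eval_label_surj g : exists h, eval_label h = g.
Proof.
suff : range eval_label g by case=> h _; exists h.
have : [set: G] g by [].
rewrite -lab_generates; apply; split=> [|_ [y _ <-]]; last first.
  by exists (sg_gen (y : S)); rewrite ?eval_label_gen.
split=> [|_ _ /set_mem [a _ <-] /set_mem [b _ <-]]; apply/mem_set.
  by exists 0%R => //; rewrite eval_label_pi [Defs.pi _]pi_invK fext0.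
exists (a - b)%R => //; apply: (addIr (eval_label b)).
by rewrite -eval_labelD !subrK.
Qed.

Lemma label_brace_iso : brace_iso (permGroup S) G.
Proof.
have act_inj : injective act.
  move=> g h E; apply: (mulIg h^-1); rewrite mulgV.
  by apply: act_faithful; rewrite actM E -actM mulgV act1.
pose F (p : permGroup S) := eval_label (pg_lift p).
(* The preimage chosen by [pg_lift] does not matter: [phi g] equals [act (eval_label g)], and [act]
   is injective. *)
have FE g : F (pg_phi g) = eval_label g.
  apply: act_inj; rewrite -!phi_eval_label.
  exact: (congr1 sval (pg_liftK (pg_phi g))).
exists F; split.
- apply: inj_surj_bijective => [p q /(congr1 act)|g].
    rewrite -!phi_eval_label => E.
    by rewrite -(pg_liftK p) -(pg_liftK q); exact: pgP.
  by have [h <-] := eval_label_surj g; exists (pg_phi h).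
- move=> p q; rewrite -(pg_liftK p) -(pg_liftK q) pg_phiD !FE.
  exact: eval_labelD.
- move=> p q; rewrite -(pg_liftK p) -(pg_liftK q) pg_phiM !FE.
  exact: eval_labelM.
Qed.

End LabelledAction.

(** * Unions of coset spaces as labelled actions *)

Section CosetUnion.
Variables (G : leftBraceType) (X : set G) (I : Type) (Xi : I -> set G).
Variables (x : I -> G) (J : I -> Type) (K : forall i, J i -> set G).
Hypothesis cd : coset_data X Xi x K.

Let CU := coset_union K.

Definition coset_act (g : G) : sym CU :=
  Sym (@coset_transK G I J K g) (@coset_transVK G I J K g).

Definition coset_label (y : CU) : G := lam (coset_repr y) (x (coset_idx y)).

Lemma coset_actM g h : coset_act (g * h) = coset_act g * coset_act h.
Proof. by apply: symP => y; rewrite symME /= coset_transM. Qed.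

Lemma lcoset_repr g (H : set G) : H 1 -> lcoset g H g.
Proof. by move=> H1; exists 1; rewrite ?mulg1. Qed.

Lemma subgroup1 i (j : J i) : K j 1.
Proof. by case: (cd_subgroup cd j) => /set_mem. Qed.

(** The representative chosen by [coset_repr] differs from [g] by a right factor in [K j], which
    fixes [x i]. *)
Lemma coset_label_mk i (j : J i) g : coset_label (mk_coset K j g) = lam g (x i).
Proof.
rewrite /coset_label /coset_repr; case: cid => h /= E.
have := lcoset_repr h (subgroup1 j).
by rewrite -E => -[k /(cd_stab cd) hk <-]; rewrite lamM hk.
Qed.

Lemma mk_coset_surj (y : CU) : exists i (j : J i) g, y = mk_coset K j g.
Proof.
case: y => i [j [C [g E]]]; exists i, j, g; exact: coset_union_eq.
Qed.

Lemma coset_label_act g y : coset_label (coset_act g y) = lam g (coset_label y).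
Proof.
have [i [j [h ->]]] := mk_coset_surj y.
by rewrite [coset_act _ _]coset_trans_mk !coset_label_mk lamM.
Qed.

Lemma mk_coset_inj i (j : J i) g h :
  mk_coset K j g = mk_coset K j h -> lcoset g (K j) = lcoset h (K j).
Proof.
by move/(congr1 (fun y : CU => sval (projT2 (projT2 y)))).
Qed.

(** If [g] fixes the coset of [h], it lies in the conjugate of [K j] by [h]; ranging over all [h],
    [i], [j] puts [g] in the trivial intersection of the cores. *)
Lemma coset_act_faithful g : coset_act g = 1 -> g = 1.
Proof.
move=> g1.
suff : (\bigcap_i \bigcap_j core (@K i j)) g by rewrite (cd_core cd).
move=> i _ j _ h _; exists (h^-1 * g * h); last first.
  by rewrite !mulgA mulgV mul1g mulgK.
have /mk_coset_inj E : mk_coset K j (g * h) = mk_coset K j h.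
  by rewrite -coset_trans_mk -[LHS]/(coset_act g _) g1.
have := lcoset_repr (g * h) (subgroup1 j); rewrite E => -[k Kk kE].
by rewrite -mulgA -kE mulKg.
Qed.

Lemma range_coset_label : range coset_label = X.
Proof.
rewrite (cd_cover cd); apply/seteqP; split=> [_ [y _ <-]|y [i _ yi]].
  have [i [j [g ->]]] := mk_coset_surj y; rewrite coset_label_mk.
  exists i => //; have [z E] := cd_orbit cd i; have := cd_base cd i.
  by rewrite E => /lam_orbit_eq <-; exists g.
have [z E] := cd_orbit cd i; have := cd_base cd i.
rewrite E => /lam_orbit_eq E'; move: yi; rewrite E -E' => -[g _ <-].
(* Nonemptiness of [J i] supplies a coset space whose labels sweep out the orbit [Xi i]. *)
have [j] := cd_nonempty cd i.
by exists (mk_coset K j g) => //; exact: coset_label_mk.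
Qed.

(** [coset_map] unfolds to the [label_map] of [coset_act] and [coset_label]. *)
Lemma coset_map_solution : is_solution (coset_map x K).
Proof. exact: (label_map_solution coset_actM coset_label_act). Qed.

Lemma coset_brace_iso : brace_iso (permGroup (Solution coset_map_solution)) G.
Proof.
apply: (label_brace_iso coset_actM coset_label_act coset_act_faithful).
by rewrite range_coset_label; exact: cd_generates cd.
Qed.

End CosetUnion.

Arguments coset_label {G I} x {J K} y.

(** * Orbit decomposition of a labelled action *)

Section OrbitDecomposition.
Variables (G : leftBraceType) (Y : Type) (act : G -> sym Y) (lab : Y -> G).
Hypothesis actM : forall g h, act (g * h) = act g * act h.
Hypothesis lab_act : forall g y, lab (act g y) = lam g (lab y).

Definition lab_orbits : Type := {U : set G | exists y, U = lam_orbit (lab y)}.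

(** Taken as the label of a point of [Y], so that the fibre over it, hence [act_orbits i], visibly
    has an element. *)
Definition orbit_base (i : lab_orbits) : G := lab (sval (cid (svalP i))).

Definition act_orbit (y : Y) : set Y := [set act g y | g in setT].

(* Every act-orbit over the label orbit i meets the fibre of orbit_base i, so
   asking for a representative there loses no orbit and puts the stabilizer of
   that representative inside the stabilizer of orbit_base i. *)
Definition act_orbits (i : lab_orbits) : Type :=
  {O : set Y | exists y, lab y = orbit_base i /\ O = act_orbit y}.

Definition orbit_pt i (j : act_orbits i) : Y := sval (cid (svalP j)).

Definition orbit_stab i (j : act_orbits i) : set G :=
  [set g | act g (orbit_pt j) = orbit_pt j].

Lemma orbit_baseE (i : lab_orbits) : sval i = lam_orbit (orbit_base i).
Proof. by rewrite /orbit_base; case: cid. Qed.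

Lemma lab_orbit_pt i (j : act_orbits i) : lab (orbit_pt j) = orbit_base i.
Proof. by rewrite /orbit_pt; case: cid => y []. Qed.

Lemma act_orbit_pt i (j : act_orbits i) : sval j = act_orbit (orbit_pt j).
Proof. by rewrite /orbit_pt; case: cid => y []. Qed.

Lemma act_orbit_refl y : act_orbit y y.
Proof. by exists 1 => //; rewrite (act1 actM). Qed.

Lemma act_orbit_act g y : act_orbit (act g y) = act_orbit y.
Proof.
apply/seteqP; split=> _ [h _ <-].
  by exists (h * g) => //; rewrite actM.
by exists (h * g^-1) => //; rewrite -symME -actM mulgVK.
Qed.

Lemma orbit_pt_cover y : exists i (j : act_orbits i) g, act g (orbit_pt j) = y.
Proof.
pose i : lab_orbits := exist _ (lam_orbit (lab y)) (ex_intro _ y erefl).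
(* Some [g] carries the label of [y] to [orbit_base i], so [act g y] represents the orbit of [y] in
   the required fibre. *)
have : sval i (orbit_base i) by rewrite orbit_baseE; exact: lam_orbit_refl.
case=> g _ gE.
have yi : exists z, lab z = orbit_base i /\ act_orbit y = act_orbit z.
  by exists (act g y); rewrite lab_act gE act_orbit_act.
pose j : act_orbits i := exist _ (act_orbit y) yi.
have := act_orbit_refl y; rewrite -[act_orbit y]/(sval j) act_orbit_pt.
by case=> h _ hE; exists i, j, h.
Qed.

(** A common point determines both indices: they are the orbit of its label and its own orbit. Pairs
    are compared because the type of [j] depends on [i]. *)
Lemma orbit_pt_index i1 (j1 : act_orbits i1) i2 (j2 : act_orbits i2) g1 g2 :
  act g1 (orbit_pt j1) = act g2 (orbit_pt j2) ->
  existT act_orbits i1 j1 = existT act_orbits i2 j2.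
Proof.
move=> E.
have Ei : i1 = i2.
  apply: eq_sig_hprop => [? ? ?|]; first exact: Prop_irrelevance.
  rewrite !orbit_baseE -(lab_orbit_pt j1) -(lab_orbit_pt j2).
  have <- : lam_orbit (lab (act g1 (orbit_pt j1))) =
      lam_orbit (lab (orbit_pt j1)).
    by apply: lam_orbit_eq; exists g1.
  by rewrite E; apply: lam_orbit_eq; exists g2.
case: i2 / Ei j2 E => j2 E; congr existT.
apply: eq_sig_hprop => [? ? ?|]; first exact: Prop_irrelevance.
by rewrite !act_orbit_pt -(act_orbit_act g1) E act_orbit_act.
Qed.

Hypothesis act_faithful : forall g, act g = 1 -> g = 1.
Hypothesis lab_generates : add_generates (range lab).

Lemma orbit_stab_closed i (j : act_orbits i) : group_closed [in orbit_stab j].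
Proof.
split=> [|g h /set_mem gj /set_mem hj]; apply/mem_set.
  by rewrite /orbit_stab /= (act1 actM).
by rewrite /orbit_stab /= -{1}hj -symME -actM mulgVK.
Qed.

Lemma orbit_coset_data :
  coset_data (range lab) (fun i : lab_orbits => sval i) orbit_base orbit_stab.
Proof.
split=> //.
- by move=> g _ [y _ <-]; exists (act g y).
- apply/seteqP; split=> [_ [y _ <-]|y [i _]].
    exists (exist _ (lam_orbit (lab y)) (ex_intro _ y erefl)) => //.
    exact: lam_orbit_refl.
  by rewrite orbit_baseE => -[g _ <-]; exists (act g (sval (cid (svalP i)))).
- move=> i1 i2 _ _ [y []]; rewrite !orbit_baseE.
  move=> /lam_orbit_eq E1 /lam_orbit_eq E2.
  apply: eq_sig_hprop => [? ? ?|]; first exact: Prop_irrelevance.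
  by rewrite !orbit_baseE -E1.
- by move=> i; exists (orbit_base i); exact: orbit_baseE.
- by move=> i; rewrite orbit_baseE; exact: lam_orbit_refl.
- move=> i; constructor; pose y := sval (cid (svalP i)).
  by exists (act_orbit y); exists y.
- by move=> i j; exact: orbit_stab_closed.
- by move=> i j g gj; rewrite /lam_stab /= -(lab_orbit_pt j) -lab_act gj.
apply/seteqP; split=> [g gK|_ ->].
  (* At a point [act h (orbit_pt j)], membership in the core gives [g = h * k * h^-1] with [k]
     fixing [orbit_pt j], so [g] fixes that point. *)
  apply: act_faithful; apply: symP => y; rewrite sym1E.
  have [i [j [h <-]]] := orbit_pt_cover y.
  have [k kj <-] := gK i Logic.I j Logic.I h Logic.I.
  by rewrite -symME -actM mulgVK actM symME kj.
move=> i _ j _ h _; exists 1; last by rewrite mulg1 mulgV.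
by have [/set_mem] := orbit_stab_closed j.
Qed.

(** On each copy of a coset space this is the orbit-stabilizer map; [orbit_map_mk] gives
    independence of the representative. *)
Definition orbit_map (y : coset_union orbit_stab) : Y :=
  act (coset_repr y) (orbit_pt (projT1 (projT2 y))).

Lemma orbit_map_mk i (j : act_orbits i) g :
  orbit_map (mk_coset orbit_stab j g) = act g (orbit_pt j).
Proof.
rewrite /orbit_map /coset_repr; case: cid => h /= E.
have := lcoset_repr h (subgroup1 orbit_coset_data j).
by rewrite -E => -[k kj <-]; rewrite actM symME kj.
Qed.

Lemma orbit_map_bij : bijective orbit_map.
Proof.
apply: inj_surj_bijective => [y1 y2|y]; last first.
  have [i [j [g <-]]] := orbit_pt_cover y.
  by exists (mk_coset orbit_stab j g); exact: orbit_map_mk.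
have [i1 [j1 [g1 ->]]] := mk_coset_surj y1.
have [i2 [j2 [g2 ->]]] := mk_coset_surj y2.
move=> E; have /orbit_pt_index jE : act g1 (orbit_pt j1) = act g2 (orbit_pt j2).
  by rewrite -!orbit_map_mk.
(* Moves the coset of [g1] over the index [j2], so that two cosets of one stabilizer remain to be
   compared. *)
have := congr1 (fun p => mk_coset orbit_stab (projT2 p) g1) jE.
move: E => /[swap] /= ->; rewrite !orbit_map_mk => E.
(* The cosets agree because [g2^-1 * g1] fixes [orbit_pt j2]. *)
apply: coset_union_eq => /=; rewrite -[g1](mulVKg g2) -lcosetM; congr lcoset.
apply/seteqP; split=> [_ [k kj <-]|k kj].
  by rewrite /orbit_stab /= !actM !symME kj E -symME -actM mulVg (act1 actM).
exists ((g2^-1 * g1)^-1 * k); rewrite ?mulVKg // invgM invgK.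
by rewrite /orbit_stab /= !actM !symME kj -E -symME -actM mulVg (act1 actM).
Qed.

Lemma orbit_map_label y : lab (orbit_map y) = coset_label orbit_base y.
Proof.
have [i [j [g ->]]] := mk_coset_surj y.
by rewrite orbit_map_mk (coset_label_mk orbit_coset_data) lab_act lab_orbit_pt.
Qed.

Lemma orbit_map_act g y :
  orbit_map (coset_act orbit_stab g y) = act g (orbit_map y).
Proof.
have [i [j [h ->]]] := mk_coset_surj y.
by rewrite [coset_act _ _ _]coset_trans_mk !orbit_map_mk actM.
Qed.

(** Both maps are [label_map]s, built from action and labels alone, and [orbit_map] respects these
    two. *)
Lemma orbit_map_morph (y z : coset_union orbit_stab) :
  label_map act lab (orbit_map y, orbit_map z) =
  let p := coset_map orbit_base orbit_stab (y, z) in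
  (orbit_map p.1, orbit_map p.2).
Proof.
rewrite -[coset_map _ _]/(label_map
  (coset_act orbit_stab) (coset_label orbit_base)).
rewrite /label_map /=; set w := act _ _.
have wE : w = orbit_map (coset_act orbit_stab (coset_label orbit_base y) z).
  by rewrite orbit_map_act -orbit_map_label.
congr (_, _); first exact: wE.
apply: (can_inj (@symK _ (act (lab w)))).
by rewrite symVK {1}wE orbit_map_label -orbit_map_act /= coset_transVK.
Qed.

End OrbitDecomposition.

(** * The labelled action carried by a solution *)

Section Converse.
Variables (G : leftBraceType) (Z : solution) (F : permGroup Z -> G).
Variable F' : G -> permGroup Z.
Hypothesis FK : cancel F F'.
Hypothesis F'K : cancel F' F.
Hypothesis FD : forall p q, F (p + q)%R = (F p + F q)%R.
Hypothesis FM : forall p q, F (p * q) = F p * F q.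

Definition sol_label (z : Z) : G := F (pg_phi (sg_gen z)).

(** Equivalently, [lam] on the structure group permutes the generators through [phi]. *)
Lemma sg_gen_add (g : structGroup Z) (z : Z) :
  g * sg_gen z = (g + sg_gen (phi g z))%R.
Proof. by apply: (@pi_inj Z); rewrite piM piD !pi_gen fperm_gen. Qed.

(** After adding [F (pg_phi g)], both sides become the image under [F] of the class of
    [g * sg_gen z]. *)
Lemma sol_label_phi g z :
  sol_label (phi g z) = lam (F (pg_phi g)) (sol_label z).
Proof.
apply: (addrI (F (pg_phi g))).
by rewrite -brace_mulE -FD pg_phiD -sg_gen_add -pg_phiM FM.
Qed.

Lemma brace_morph0 : F 0%R = 0%R.
Proof. by apply: (addrI (F 0%R)); rewrite -FD !addr0. Qed.

Lemma brace_morphN p : F (- p)%R = (- F p)%R.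
Proof. by apply: (addrI (F p)); rewrite -FD !subrr brace_morph0. Qed.

Lemma pg_phiN g : pg_phi (- g)%R = (- pg_phi g)%R :> permGroup Z.
Proof. by apply: (addrI (pg_phi g)); rewrite pg_phiD !subrr. Qed.

Lemma sol_label_generates : add_generates (range sol_label).
Proof.
apply/seteqP; split=> // g _ A [/= A_zmod Alab].
have A0 : A 0%R by case: A_zmod => /set_mem.
have AB u v : A u -> A v -> A (u - v)%R.
  case: A_zmod => _ A_sub /mem_set Au /mem_set Av; apply/set_mem.
  exact: A_sub Au Av.
have AD u v : A u -> A v -> A (u + v)%R.
  move=> Au Av; rewrite -[v]opprK -[(- v)%R]sub0r.
  by apply: (AB) => //; apply: AB.
rewrite -(F'K g) -(pg_liftK (F' g)).
rewrite -(piK (pg_lift _)).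
elim/freeab_ind: (Defs.pi _) => [|z a Aa|z a Aa].
- by rewrite (_ : pg_phi _ = 0%R) ?brace_morph0.
- have -> : Defs.pi_inv (a + fgen z)%R = (Defs.pi_inv a + sg_gen z)%R.
    by rewrite sg_addE pi_invK pi_gen.
  by rewrite -pg_phiD FD; apply: AD => //; apply: Alab; exists z.
- have -> : Defs.pi_inv (a - fgen z)%R = (Defs.pi_inv a - sg_gen z)%R.
    by apply: (@pi_inj Z); rewrite piD [Defs.pi (- _)%R]pi_invK !pi_invK pi_gen.
  rewrite -pg_phiD pg_phiN FD brace_morphN.
  by apply: AB => //; apply: Alab; exists z.
Qed.

Definition sol_act (g : G) : sym Z := sval (F' g).

Lemma sol_actM g h : sol_act (g * h) = sol_act g * sol_act h.
Proof. by rewrite /sol_act -{1}(F'K g) -{1}(F'K h) -FM FK. Qed.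

Lemma sol_act_phi g : sol_act (F (pg_phi g)) = phi g.
Proof. by rewrite /sol_act FK. Qed.

Lemma sol_label_act g z : sol_label (sol_act g z) = lam g (sol_label z).
Proof. by rewrite -(F'K g) -(pg_liftK (F' g)) sol_act_phi sol_label_phi. Qed.

Lemma sol_act_faithful g : sol_act g = 1 -> g = 1.
Proof.
move=> g1; have F1 : F 1 = 1 by apply: (mulgI (F 1)); rewrite -FM !mulg1.
by rewrite -(F'K g) -F1; congr F; exact: pgP.
Qed.

(** The label of [z] acts as [sigp z], and involutivity, in the form [gamE], fixes the second
    component. *)
Lemma sol_label_map x y :
  sol_map (x, y) = label_map sol_act sol_label (x, y) :> Z * Z.
Proof.
by rewrite solE gamE /label_map /= /sol_label !sol_act_phi !phi_gen.
Qed.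

End Converse.

Theorem theorem3p1 (G : leftBraceType) :
  (forall (X : set G) (I : Type) (Xi : I -> set G) (x : I -> G)
      (J : I -> Type) (K : forall i : I, J i -> set G),
    coset_data X Xi x K ->
    exists hs : is_solution (coset_map x K),
      brace_iso (permGroup (Solution hs)) G)
  /\
  (forall Z : solution, brace_iso (permGroup Z) G ->
    exists (X : set G) (I : Type) (Xi : I -> set G) (x : I -> G)
      (J : I -> Type) (K : forall i : I, J i -> set G),
    coset_data X Xi x K /\
    exists hs : is_solution (coset_map x K),
      solution_iso Z (Solution hs)).
Proof.
split=> [X I Xi x J K cd|Z [F [[F' FK F'K] FD FM]]].
  by exists (coset_map_solution cd); exact: coset_brace_iso.
have actM := sol_actM FK F'K FM.
have lab_act := sol_label_act FK F'K FD FM.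
have faithful := sol_act_faithful F'K FM.
have generates := sol_label_generates F'K FD.
have cd := orbit_coset_data actM lab_act faithful generates.
do 6 eexists; split; first exact: cd.
exists (coset_map_solution cd).
(* [orbit_map] goes from the coset union to [Z], so the isomorphism sought is its inverse [Psi]. *)
have [Psi PhiK PsiK] := orbit_map_bij actM lab_act faithful generates.
exists Psi; split; first exact: Bijective PsiK PhiK.
move=> x y; rewrite (sol_label_map FK) -[x in RHS]PsiK -[y in RHS]PsiK.
rewrite (orbit_map_morph actM lab_act faithful generates) /=.
by rewrite !PhiK.
Qed.
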